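(* Let $(M_t)$ be a strictly positive, continuous local martingale with $M_0=1$, let $I_t=\inf_{s\le t}M_s$, and let $$Y^\star_t=\frac{M_t}{I_t}-1.$$ Let $\mathcal{E}(M)$ be the set of all nonnegative local submartingales with martingale part $M$ in their multiplicative decomposition. Then $(Y^\star_t)$ is in $\mathcal{E}(M)$ and it is the smallest element of $\mathcal{E}(M)$, in the sense that $$\forall\, Y\in\mathcal{E}(M),\qquad Y^\star\le Y.$$ Consequently, $(Y^\star_t)$ has more zeros than any other local submartingale of $\mathcal{E}(M)$, i.e. $\{t: Y_t=0\}\subset\{t: Y^\star_t=0\}$ for every $Y\in\mathcal{E}(M)$.
   Context: All processes live on a filtered probability space $(\Omega,\mathcal{F},(\mathcal{F}_t)_{t\ge0},\mathbb{P})$ satisfying the usual assumptions. Every continuous nonnegative local submartingale $Y$ with $Y_0=0$ has a unique multiplicative decomposition $Y_t=M_tC_t-1$, where $M$ (the martingale part) is a continuous strictly positive local martingale with $M_0=1$ and $C$ is a continuous, adapted, increasing (nondecreasing) process with $C_0=1$. Thus $\mathcal{E}(M)$ is the set of continuous nonnegative local submartingales $Y$ with $Y_0=0$ of the form $Y_t=M_tC_t-1$ with the given $M$ and some such $C$. Inequalities and inclusions between processes and random sets hold for all $t\ge 0$, almost surely. *)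

(* Defs.v *)
From HB Require Import structures.
From mathcomp Require Import all_boot all_order all_algebra.
From mathcomp Require Import all_classical all_reals all_analysis.
Import Order.TTheory GRing.Theory Num.Theory.
Import numFieldNormedType.Exports.

Set Implicit Arguments.
Unset Strict Implicit.
Unset Printing Implicit Defensive.

Local Open Scope classical_set_scope.
Local Open Scope ring_scope.

(* Time is [0, +oo[ inside R: processes and filtrations are functions on all
   of R, but every definition only inspects them at times t >= 0. *)

Section processes.
Context {d : measure_display} {T : measurableType d} {R : realType}.
Variable P : probability T R.

(* [P.-negligible A] does not require A measurable, so the completeness
   clause below also makes the underlying sigma-algebra P-complete. *)
Record usual_filtration (F : R -> set (set T)) : Prop := {
  filtration_sigma_algebra :
    forall t, 0 <= t -> sigma_algebra setT (F t) ;
  filtration_measurable :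
    forall t, 0 <= t -> F t `<=` (measurable : set (set T)) ;
  filtration_nondecreasing :
    forall s t, 0 <= s -> s <= t -> F s `<=` F t ;
  filtration_right_continuous :
    forall t, 0 <= t -> \bigcap_(s in [set s | t < s]) F s = F t ;
  filtration_complete :
    forall A : set T, P.-negligible A -> F 0 A }.

Definition measurable_wrt (G : set (set T)) (X : T -> R) : Prop :=
  measurable_fun (setT : set (g_sigma_algebraType G)) X.

(* Z is a version of the conditional expectation E[X | G]. *)
Definition is_cond_exp (G : set (set T)) (X Z : T -> R) : Prop :=
  [/\ measurable_wrt G Z,
      P.-integrable setT (EFin \o Z) &
      forall A, G A ->
        (\int[P]_(w in A) (Z w)%:E = \int[P]_(w in A) (X w)%:E)%E].

Definition continuous_process (X : R -> T -> R) : Prop :=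
  {ae P, forall w, {within `[0, +oo[, continuous (fun t => X t w)}}.

Definition nondecreasing_process (X : R -> T -> R) : Prop :=
  {ae P, forall w, forall s t, 0 <= s -> s <= t -> X s w <= X t w}.

Definition starts_at (x : R) (X : R -> T -> R) : Prop :=
  {ae P, forall w, X 0 w = x}.

Definition le_process (X Y : R -> T -> R) : Prop :=
  {ae P, forall w, forall t, 0 <= t -> X t w <= Y t w}.

Definition positive_process (X : R -> T -> R) : Prop :=
  {ae P, forall w, forall t, 0 <= t -> 0 < X t w}.

Definition zeros (X : R -> T -> R) (w : T) : set R :=
  [set t | 0 <= t /\ X t w = 0].

Section filtered.
Variable F : R -> set (set T).

Definition adapted (X : R -> T -> R) : Prop :=
  forall t, 0 <= t -> measurable_wrt (F t) (X t).

Definition martingale (X : R -> T -> R) : Prop :=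
  [/\ adapted X,
      forall t, 0 <= t -> P.-integrable setT (EFin \o X t) &
      forall s t, 0 <= s -> s <= t -> is_cond_exp (F s) (X t) (X s)].

Definition submartingale (X : R -> T -> R) : Prop :=
  [/\ adapted X,
      forall t, 0 <= t -> P.-integrable setT (EFin \o X t) &
      forall s t, 0 <= s -> s <= t ->
        exists2 Z : T -> R, is_cond_exp (F s) (X t) Z &
                            {ae P, forall w, X s w <= Z w}].

Definition stopping_time (tau : T -> \bar R) : Prop :=
  (forall w, 0%E <= tau w)%E /\
  (forall t, 0 <= t -> F t [set w | (tau w <= t%:E)%E]).

(* min(t, tau w) lies in [0, t] when tau is a stopping time, so [fine] loses
   nothing. *)
Definition stopped (X : R -> T -> R) (tau : T -> \bar R) (t : R) (w : T) : R :=
  X (fine (Order.min t%:E (tau w))) w.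

Definition localizing (tau : nat -> T -> \bar R) : Prop :=
  [/\ forall n, stopping_time (tau n),
      {ae P, forall w, forall m n, (m <= n)%N -> (tau m w <= tau n w)%E} &
      {ae P, forall w, tau n w @[n --> \oo] --> +oo%E}].

(* The stopped processes themselves are required to be (sub)martingales, with
   no correction by the initial value: every local (sub)martingale considered
   here starts at a constant, for which the usual variants agree. *)
Definition local_martingale (X : R -> T -> R) : Prop :=
  adapted X /\
  exists2 tau, localizing tau & forall n, martingale (stopped X (tau n)).

Definition local_submartingale (X : R -> T -> R) : Prop :=
  adapted X /\
  exists2 tau, localizing tau & forall n, submartingale (stopped X (tau n)).

Definition martingale_part (M : R -> T -> R) : Prop :=
  [/\ continuous_process M, positive_process M, local_martingale M &
      starts_at 1 M].

(* Y = M C - 1, with martingale part M and increasing part C. *)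
Definition multiplicative_decomposition (Y M C : R -> T -> R) : Prop :=
  [/\ martingale_part M,
      [/\ continuous_process C, adapted C, nondecreasing_process C &
          starts_at 1 C] &
      {ae P, forall w, forall t, 0 <= t -> Y t w = M t w * C t w - 1}].

(* E(M) *)
Definition submartingales_with_part (M : R -> T -> R) : set (R -> T -> R) :=
  [set Y | [/\ continuous_process Y, le_process (fun _ _ => 0) Y,
               local_submartingale Y, starts_at 0 Y &
               exists C, multiplicative_decomposition Y M C]].

End filtered.
End processes.

Section running_infimum.
Context {T : Type} {R : realType}.
Implicit Type M : R -> T -> R.

Definition running_inf M (t : R) (w : T) : R := inf [set M s w | s in `[0, t]].

Definition Ystar M (t : R) (w : T) : R := M t w / running_inf M t w - 1.

End running_infimum.

(* Main.v *)
(* The factor C of Y = M C - 1 is nondecreasing and C_s >= 1/M_s, as Y_s >= 0;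
   taking for s a time at which M attains its infimum over [0, t] gives
   C_t >= 1/I_t, which is the minimality of Ystar.

   The point of membership is the local submartingale property. Let N be M
   stopped at a localizing time, J its running infimum, and stop N/J - 1 when J
   reaches a level e: this gives V_t = N_t/J_t - 1 on {J_t > e} and V_t = 0 on
   {J_t <= e}. For A in F_s with A contained in {e < J_s <= c},
     c E[V_t + 1; A] >= E[N_t; A, J_t > e] + e P(A, J_t <= e) >= E[N_t; A] = E[N_s; A],
   where the second inequality is the maximal inequality
   E[N_t; A, J_t <= e] <= e P(A, J_t <= e), obtained by optional stopping along
   finite sets of times. Letting c range over the rationals above J_s yields
   E[V_t | F_s] + 1 >= N_s/J_s on {J_s > e}, without multiplying conditional
   expectations by J_s. *)
Require Import Defs.
From HB Require Import structures.
From mathcomp Require Import all_boot all_order all_algebra.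
From mathcomp Require Import all_classical all_reals all_analysis.
From mathcomp Require Import measurable_realfun ring lra.
Import Order.TTheory GRing.Theory Num.Theory.
Import numFieldNormedType.Exports.

Set Implicit Arguments.
Unset Strict Implicit.
Unset Printing Implicit Defensive.

Local Open Scope classical_set_scope.
Local Open Scope ring_scope.

(** * Continuous paths on the half-line and their running infimum *)

Section paths.
Context {R : realType}.
Implicit Types (f g : R -> R) (a b c e s t u : R).

Lemma continuous_halflineP f :
  {within `[0, +oo[, continuous f} <->
  forall t e, 0 <= t -> 0 < e -> exists2 r, 0 < r &
    forall u, 0 <= u -> `|t - u| < r -> `|f t - f u| < e.
Proof.
split=> [/subspace_continuousP fc t e t0 e0|H].
  have /fc/cvgrPdist_lt/(_ _ e0) : `[0, +oo[%classic t.
    by rewrite /= in_itv /= t0.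
  rewrite near_withinE => /nbhs_ballP[r /= r0 rP]; exists r => // u u0 tu.
  by apply: rP => //=; rewrite in_itv /= u0.
apply/subspace_continuousP => t; rewrite /= in_itv /= andbT => t0.
apply/cvgrPdist_lt => e e0; have [r r0 rP] := H t e t0 e0.
rewrite near_withinE; apply/nbhs_ballP; exists r => //= u tu.
by rewrite in_itv /= andbT => u0; exact: rP.
Qed.

Lemma continuous_halfline_itv f a b : 0 <= a ->
  {within `[0, +oo[, continuous f} -> {within `[a, b], continuous f}.
Proof.
move=> a0; apply: continuous_subspaceW => u /=; rewrite !in_itv /= andbT.
by case/andP => /(le_trans a0).
Qed.

(** Continuity keeps [f] below [c] near [u], and clamping a nearby rational to [a, b] brings it no
    farther from [u]. Clamping, rather than choosing rationals inside the interval, also covers a =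
    b. This turns an uncountable union of events into a countable one. *)
Lemma lt_on_itv_rat f a b c : 0 <= a -> a <= b ->
  {within `[0, +oo[, continuous f} ->
  (exists2 u, a <= u <= b & f u < c) <->
  (exists q : rat, f (Num.max a (Num.min b (ratr q))) < c).
Proof.
move=> a0 ab /continuous_halflineP fc; split=> [[u /andP[au ub] fu]|[q fq]].
  have [r r0 rP] := fc u (c - f u) (le_trans a0 au) ltac:(by rewrite subr_gt0).
  have [q] := @rat_in_itvoo R (u - r) (u + r) ltac:(lra).
  rewrite in_itv /= => /andP[q1 q2]; exists q.
  set v := Num.max _ _.
  have : `|f u - f v| < c - f u.
    apply: rP; first by rewrite le_max a0.
    by rewrite /v ltr_norml; apply/andP; split; case: (ltP b (ratr q)) => h1;
       [case: (ltP a b)|case: (ltP a (ratr q))|case: (ltP a b)|case: (ltP a (ratr q))] => h2; lra.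
  rewrite ltr_norml => /andP[]; lra.
exists (Num.max a (Num.min b (ratr q))) => //.
by rewrite le_max lexx /= ge_max ab ge_min lexx.
Qed.

Section running_infimum_path.
Context {T : Type} (M : R -> T -> R) (w : T).
Hypothesis Mc : {within `[0, +oo[, continuous (fun t => M t w)}.

Lemma running_inf_attained t : 0 <= t -> exists2 u, 0 <= u <= t &
  running_inf M t w = M u w /\ forall s, 0 <= s <= t -> M u w <= M s w.
Proof.
move=> t0; have [u] := EVT_min t0 (continuous_halfline_itv (lexx 0) Mc).
rewrite in_itv /= => ut uP; exists u => //.
have lbu s : 0 <= s <= t -> M u w <= M s w.
  by move=> st; apply: uP; rewrite in_itv.
split=> //; apply/eqP; rewrite eq_le; apply/andP; split.
  apply: ge_inf; last by exists u; rewrite /= ?in_itv.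
  by exists (M u w) => _ [s + <-] /=; rewrite ?in_itv /=; exact: lbu.
apply: lb_le_inf; first by exists (M u w), u; rewrite /= ?in_itv.
by move=> _ [s + <-] /=; rewrite ?in_itv /=; exact: lbu.
Qed.

Lemma running_inf_le s t : 0 <= s <= t -> running_inf M t w <= M s w.
Proof.
move=> /[dup]/andP[s0 st] s0t.
by have [u _ [-> ->]] := running_inf_attained (le_trans s0 st).
Qed.

Lemma running_inf_antitone s t : 0 <= s -> s <= t ->
  running_inf M t w <= running_inf M s w.
Proof.
move=> s0 st; have [u /andP[u0 us] [-> _]] := running_inf_attained s0.
by apply: running_inf_le; rewrite u0 (le_trans us).
Qed.

Lemma running_inf_leP t c : 0 <= t ->
  running_inf M t w <= c <-> exists2 u, 0 <= u <= t & M u w <= c.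
Proof.
move=> t0; split=> [|[u ut]]; last by apply/le_trans/running_inf_le.
by have [u ut [-> _]] := running_inf_attained t0; exists u.
Qed.

Lemma running_inf_ltP t c : 0 <= t ->
  running_inf M t w < c <-> exists2 u, 0 <= u <= t & M u w < c.
Proof.
move=> t0; split=> [|[u ut]]; last by apply/le_lt_trans/running_inf_le.
by have [u ut [-> _]] := running_inf_attained t0; exists u.
Qed.

Lemma running_inf_gt0 t : 0 <= t -> (forall s, 0 <= s -> 0 < M s w) ->
  0 < running_inf M t w.
Proof.
by move=> t0 M0; have [u /andP[u0 _] [-> _]] := running_inf_attained t0; exact: M0.
Qed.

Lemma running_inf0 : running_inf M 0 w = M 0 w.
Proof.
have [u /andP[u0 u1] [-> _]] := running_inf_attained (lexx 0).
by have -> : u = 0 by apply/eqP; rewrite eq_le u0 u1.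
Qed.

Lemma continuous_running_inf :
  {within `[0, +oo[, continuous (fun t => running_inf M t w)}.
Proof.
apply/continuous_halflineP => t e t0 e0.
have [r r0 rP] := (continuous_halflineP _).1 Mc t (e / 2) t0 ltac:(lra).
have half a b : 0 <= a -> a <= b -> `|t - a| < r -> `|t - b| < r ->
    `|running_inf M a w - running_inf M b w| < e.
  move=> a0 ab ta tb; have b0 := le_trans a0 ab.
  have anti := running_inf_antitone a0 ab.
  rewrite ger0_norm ?subr_ge0 //.
  have [u /andP[u0 ub] [-> _]] := running_inf_attained b0.
  (* Either the minimiser [u] over [0, b] already lies in [0, a], so the two infima agree, or it
     lies in ]a, b]. Then the infima differ by at most [M a w - M u w], and both values are within
     e/2 of [M t w]. *)
  have [ua|au] := leP u a.
    have := @running_inf_le u a; rewrite u0 ua => /(_ isT); lra.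
  have := @running_inf_le a a; rewrite a0 lexx => /(_ isT).
  have := rP a a0 ta; have : `|t - u| < r.
    by move: ta tb; rewrite !ltr_norml => /andP[? ?] /andP[? ?]; lra.
  move=> /(rP u u0); rewrite !ltr_norml => /andP[? ?] /andP[? ?]; lra.
exists r => // u u0 tu; have tt : `|t - t| < r by rewrite subrr normr0.
have [|/ltW] := leP t u => h; first exact: half.
by rewrite distrC; apply: half.
Qed.

End running_infimum_path.
End paths.

(** * Measurability with respect to a sub-sigma-algebra *)

Section measurability_wrt.
Context {d : measure_display} {T : measurableType d} {R : realType}.
Implicit Types (G : set (set T)) (X : T -> R) (A B : set T).

Lemma measurable_wrtP G X : sigma_algebra setT G ->
  measurable_wrt G X <-> forall c, G [set w | X w < c].
Proof.
move=> sG; split=> [mX c|GX].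
  rewrite -(sigma_algebra_id sG).
  have := mX measurableT `]-oo, c[%classic (measurable_itv _); rewrite setTI.
  by congr (<<s _ >> _); apply/seteqP; split=> w /=; rewrite in_itv.
apply: (measurability (@RGenInftyO.G R)).
  exact: RGenInftyO.measurableE.
move=> _ [_ [c ->] <-]; rewrite setTI; apply: sub_sigma_algebra.
by have := GX c; congr (G _); apply/seteqP; split=> w /=; rewrite in_itv.
Qed.

Lemma measurable_wrt_measurable_fun G X :
  sigma_algebra setT G -> G `<=` (measurable : set (set T)) ->
  measurable_wrt G X -> measurable_fun setT X.
Proof.
move=> sG Gm mX _ B mB; apply: Gm; rewrite -(sigma_algebra_id sG).
exact: mX.
Qed.

End measurability_wrt.

(** * Events of a filtration satisfying the usual conditions *)

Section filtration.
Context {d : measure_display} {T : measurableType d} {R : realType}.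
Variables (P : probability T R) (F : R -> set (set T)).
Hypothesis uF : usual_filtration P F.
Implicit Types (s t : R) (A B : set T) (X Y : T -> R).

Let sF t : 0 <= t -> sigma_algebra setT (F t).
Proof. exact: (filtration_sigma_algebra uF). Qed.

Lemma filtration_setC t A : 0 <= t -> F t A -> F t (~` A).
Proof. by move=> /sF[_ + _] FA => /(_ _ FA); rewrite setTD. Qed.

Lemma filtration_bigcup t (A : (set T)^nat) : 0 <= t ->
  (forall n, F t (A n)) -> F t (\bigcup_n A n).
Proof. by move=> /sF[_ _ +] FA; apply. Qed.

Lemma filtration_setU t A B : 0 <= t -> F t A -> F t B -> F t (A `|` B).
Proof.
move=> t0 FA FB; rewrite -bigcup2E; apply: filtration_bigcup => // -[|[|n]] //=.
by case: (sF t0).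
Qed.

Lemma filtration_setI t A B : 0 <= t -> F t A -> F t B -> F t (A `&` B).
Proof.
move=> t0 FA FB; rewrite -[A]setCK -[B]setCK -setCU.
by apply: filtration_setC => //; apply: filtration_setU => //;
  exact: filtration_setC.
Qed.

Lemma filtration_negligible t A : 0 <= t -> P.-negligible A -> F t A.
Proof.
move=> t0 NA; apply: (filtration_nondecreasing uF (lexx 0) t0).
exact: (filtration_complete uF).
Qed.

(** [A] and [B] differ inside a null set, and completeness puts every subset of a null set in [F t].
    Path properties that hold only almost surely can thus be used to prove adaptedness. *)
Lemma filtration_ae t A B : 0 <= t ->
  {ae P, forall w, A w <-> B w} -> F t A -> F t B.
Proof.
move=> t0 AB FA; set N := ~` [set w | A w <-> B w].
have -> : B = (A `&` ~` N) `|` (B `&` N).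
  apply/seteqP; split=> w; have [Nw|Nw] := pselect (N w).
  - by move=> Bw; right.
  - by move=> Bw; left; split=> //; move: Nw; rewrite /N /= => /contrapT[_]; apply.
  - by move=> [[_ /(_ Nw)]//|[]].
  - by move=> [[Aw _]|[]//]; move: Nw; rewrite /N /= => /contrapT[+ _]; apply.
apply: filtration_setU => //.
  apply: filtration_setI => //; apply: filtration_setC => //.
  exact: filtration_negligible.
apply: filtration_negligible => //; apply: negligibleS AB.
exact: subIsetr.
Qed.

Lemma measurable_wrt_ae t X Y : 0 <= t -> {ae P, forall w, X w = Y w} ->
  measurable_wrt (F t) X -> measurable_wrt (F t) Y.
Proof.
move=> t0 XY /(measurable_wrtP _ (sF t0)) FX.
apply/(measurable_wrtP _ (sF t0)) => c; apply: filtration_ae (FX c) => //.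
by apply: filterS XY => w /= ->.
Qed.

Lemma filtration_ltr t X Y : 0 <= t -> measurable_wrt (F t) X ->
  measurable_wrt (F t) Y -> F t [set w | X w < Y w].
Proof.
move=> t0 mX mY; have := measurable_fun_ltr mX mY.
move=> /(_ measurableT [set true] I); rewrite setTI.
by rewrite /measurable /= (sigma_algebra_id (sF t0)).
Qed.

Lemma adapted_measurable_fun X t : 0 <= t -> measurable_wrt (F t) X ->
  measurable_fun setT X.
Proof.
move=> t0; apply: measurable_wrt_measurable_fun; first exact: sF.
exact: (filtration_measurable uF).
Qed.

Lemma filtration_exists_rat t (A : rat -> set T) : 0 <= t ->
  (forall q, F t (A q)) -> F t [set w | exists q, A q w].
Proof.
move=> t0 FA; rewrite (_ : [set w | _] = \bigcup_n
    (if unpickle n is Some q then A q else set0)).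
  by apply: filtration_bigcup => // n; case: unpickle => // ; case: (sF t0).
apply/seteqP; split=> w; last by move=> [n _]; case: (unpickle n) => // q; exists q.
by move=> [q Aq]; exists (pickle q); [exact: I|rewrite pickleK].
Qed.

Lemma filtration_lt_on_itv (N : R -> T -> R) s t c : 0 <= s -> s <= t ->
  adapted F N -> continuous_process P N ->
  F t [set w | exists2 u, s <= u <= t & N u w < c].
Proof.
move=> s0 st aN cN; have t0 := le_trans s0 st.
apply: (@filtration_ae _ [set w | exists q : rat,
    N (Num.max s (Num.min t (ratr q))) w < c]) => //.
  by apply: filterS cN => w Nw /=; apply: iff_sym; exact: lt_on_itv_rat.
apply: filtration_exists_rat => // q; set u := Num.max _ _.
have u0 : 0 <= u by rewrite le_max s0.
have ut : u <= t by rewrite ge_max st ge_min lexx.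
apply: (filtration_nondecreasing uF u0 ut).
exact: (measurable_wrtP _ (sF u0)).1 (aN _ u0) c.
Qed.

Lemma adapted_running_inf (N : R -> T -> R) :
  adapted F N -> continuous_process P N -> adapted F (running_inf N).
Proof.
move=> aN cN t t0; apply/(measurable_wrtP _ (sF t0)) => c.
apply: filtration_ae (filtration_lt_on_itv c (lexx 0) t0 aN cN) => //.
apply: filterS cN => w Nw /=; apply: iff_sym; exact: running_inf_ltP.
Qed.

End filtration.

(** * Signs of integrals, and their passage to the limit *)

Section integral_sign.
Context {d : measure_display} {T : measurableType d} {R : realType}.
Variable P : {measure set T -> \bar R}.
Implicit Types (A : set T) (f g : T -> R).
Local Open Scope ereal_scope.

(** The L1 norm of [f] on [A] vanishes, so [f] is zero almost everywhere there, which strict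
    positivity forbids. An almost sure inequality follows by taking for [A] the event where it
    fails. *)
Lemma negligible_integral_le0 A f : measurable A ->
  P.-integrable A (EFin \o f) -> (forall w, A w -> (0 < f w)%R) ->
  \int[P]_(w in A) (f w)%:E <= 0 -> P.-negligible A.
Proof.
move=> mA fi f0 If.
have : \int[P]_(w in A) `|(EFin \o f) w| = 0.
  apply/eqP; rewrite eq_le integral_ge0 // andbT; apply: le_trans If.
  rewrite le_eqVlt; apply/orP; left; apply/eqP; apply: eq_integral => w.
  by rewrite inE => /f0 /ltW fw /=; rewrite ger0_norm.
move=> /(ae_eq_integral_abs P mA (measurable_int _ fi)).
apply: negligibleS => w Aw /= /(_ Aw) [fw].
by have := f0 _ Aw; rewrite fw ltxx.
Qed.

(* Dominated convergence, keeping only the sign of the limit. *)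
Lemma dominated_integral_le0 (B_ : (set T)^nat) (B : set T)
    (f_ : (T -> R)^nat) f g :
  (forall n, measurable (B_ n)) -> measurable B ->
  (forall n, measurable_fun setT (f_ n)) -> measurable_fun setT f ->
  {ae P, forall w, \forall n \near \oo, B_ n w <-> B w} ->
  (forall w, f_ n w @[n --> \oo] --> f w) ->
  P.-integrable setT (EFin \o g) ->
  (forall n w, (`|f_ n w| <= g w)%R) ->
  (forall n, \int[P]_(w in B_ n) (f_ n w)%:E <= 0) ->
  \int[P]_(w in B) (f w)%:E <= 0.
Proof.
move=> mB_ mB mf_ mf BB ff ig fg If_.
rewrite [leLHS]integral_mkcond.
have [] := @dominated_convergence _ _ _ P setT measurableT
  (fun n => (EFin \o f_ n) \_ (B_ n)) ((EFin \o f) \_ B) (EFin \o g).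
- move=> n; apply/(measurable_restrictT _ (mB_ n)).
  by apply: measurable_funTS; exact/measurable_EFinP.
- apply/(measurable_restrictT _ mB).
  by apply: measurable_funTS; exact/measurable_EFinP.
- apply: filterS BB => w Bw _; rewrite restrict_EFin.
  apply: cvg_EFin => /=; first by apply: nearW => n; rewrite restrict_EFin.
  (* With the limiting indicator the convergence is immediate, and for almost every [w] the
     indicators of [B_ n] and [B] eventually agree at [w]. *)
  have cvgB : (f_ n w * \1_B w)%R @[n --> \oo] --> (f w * \1_B w)%R.
    by apply: cvgM (ff w) _; exact: cvg_cst.
  rewrite patch_indic; apply: cvg_trans cvgB; apply: near_eq_cvg.
  apply: filterS Bw => n Bw; rewrite /= restrict_EFin /= patch_indic.
  by rewrite !indicE; congr (_ * (nat_of_bool _)%:R)%R; apply/idP/idP; rewrite !in_setE => /Bw.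
- exact: ig.
- apply: aeW => w n _; rewrite restrict_EFin /= lee_fin patchE.
  by case: ifP => // _; rewrite normr0 (le_trans _ (fg n w)).
move=> _ _; apply: cvge_le; apply: nearW => n.
by rewrite /= -integral_mkcond; exact: If_.
Qed.

End integral_sign.

(** * Existence of conditional expectations *)

Section conditional_expectation.
Context {d : measure_display} {T : measurableType d} {R : realType}.
Variables (P : probability T R) (G : set (set T)).
Hypotheses (sG : sigma_algebra setT G) (Gm : G `<=` (measurable : set (set T))).
Implicit Types (X Y Z : T -> R).

Let toG : T -> g_sigma_algebraType G := id.

Let measurable_toG : measurable_fun setT toG.
Proof.
move=> _ B mB; rewrite setTI; apply: Gm.
by rewrite -(sigma_algebra_id sG).
Qed.

(* The density of the measure [A |-> E[X; A]] on the smaller sigma-algebra. *)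
Lemma cond_exp_exists X : P.-integrable setT (EFin \o X) ->
  exists Z, is_cond_exp P G X Z.
Proof.
move=> iX.
(* The law of the identity, seen as a map into the space carrying only [G], is the restriction of
   [P] to [G]. A density with respect to it is automatically [G]-measurable. *)
pose idG : {mfun T >-> g_sigma_algebraType G} :=
  HB.pack toG (isMeasurableFun.Build _ _ _ _ toG measurable_toG).
pose mu : probability (g_sigma_algebraType G) R := distribution P idG.
have domX : induced_charge iX `<< P.
  apply/null_content_dominatesP => A mA PA0.
  rewrite /induced_charge null_set_integral//.
  by apply: measurable_funTS; exact: measurable_int iX.
have density (nu : {charge set (g_sigma_algebraType G) -> \bar R}) :
    nu `<< mu -> (forall A, nu A = \int[P]_(w in A) (X w)%:E)%E ->
    exists Z, is_cond_exp P G X Z.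
  move=> numu nuE; set h := Radon_Nikodym nu mu.
  have ih : mu.-integrable setT h by exact: Radon_Nikodym_integrable.
  have mh := measurable_int _ ih.
  have hE : EFin \o (fine \o h) = h.
    by apply/funext => w /=; rewrite fineK// Radon_Nikodym_fin_num.
  have ihP : P.-integrable setT h.
    apply/integrableP; split.
      move=> _ B mB; apply: Gm; rewrite -(sigma_algebra_id sG).
      exact: mh.
    have /integrableP[_] := ih; rewrite ge0_integral_pushforward//.
    exact: measurableT_comp.
  exists (fine \o h); split.
  - by apply: measurableT_comp => //; exact: measurable_fine.
  - by rewrite hE.
  - move=> A GA; rewrite -nuE.
    have mA : measurable (A : set (g_sigma_algebraType G)).
      by rewrite /measurable /= (sigma_algebra_id sG).
    rewrite (Radon_Nikodym_integral numu mA) integral_pushforward //.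
      by apply: eq_integral => w _ /=; rewrite fineK// Radon_Nikodym_fin_num.
    by apply: integrableS ihP => //; apply: Gm.
by apply: density (dominates_pushforward measurable_toG domX) _.
Qed.

End conditional_expectation.

(** * The maximal inequality for the running infimum of a continuous martingale *)

Section maximal_inequality.
Context {d : measure_display} {T : measurableType d} {R : realType}.
Variables (P : probability T R) (F : R -> set (set T)) (N : R -> T -> R).
Hypotheses (uF : usual_filtration P F) (Nmart : martingale P F N)
  (Ncont : continuous_process P N).
Implicit Types (s t u e : R) (A B : set T).

Let Nadapted : adapted F N. Proof. by case: Nmart. Qed.

Let sF t : 0 <= t -> sigma_algebra setT (F t).
Proof. exact: (filtration_sigma_algebra uF). Qed.

Let mF t A : 0 <= t -> F t A -> measurable A.
Proof. by move=> t0; exact: (filtration_measurable uF t0). Qed.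

Let mN t : 0 <= t -> measurable_fun setT (N t).
Proof. by move=> t0; apply: (adapted_measurable_fun uF t0); exact: Nadapted. Qed.

Lemma integrable_subcst t e A : 0 <= t -> measurable A ->
  P.-integrable A (EFin \o (fun w => N t w - e)).
Proof.
move=> t0 mA; apply: (integrableS measurableT) => //.
rewrite (_ : _ \o _ = fun w => (EFin \o N t) w - (EFin \o cst e) w)%E //.
apply: integrableB => //; first by case: Nmart => _ + _; apply.
exact: finite_measure_integrable_cst.
Qed.

Lemma martingale_integral_subcst s t e A : 0 <= s -> s <= t -> F s A ->
  (\int[P]_(w in A) (N t w - e)%:E = \int[P]_(w in A) (N s w - e)%:E)%E.
Proof.
move=> s0 st FA; have t0 := le_trans s0 st; have mA := mF s0 FA.
have iN u : 0 <= u -> P.-integrable A (EFin \o N u).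
  by move=> u0; apply: (integrableS measurableT) => //; case: Nmart => _ + _; apply.
have ie : P.-integrable A (EFin \o cst e).
  by apply: (integrableS measurableT) => //; exact: finite_measure_integrable_cst.
under eq_integral do rewrite EFinB.
rewrite (integralB_EFin mA (iN t t0) ie).
under [RHS]eq_integral do rewrite EFinB.
rewrite (integralB_EFin mA (iN s s0) ie); congr (_ - _)%E.
by case: Nmart => _ _ /(_ s t s0 st)[_ _ /(_ A FA)].
Qed.

Lemma filtration_has_lt t e (l : seq R) : 0 <= t -> all (fun u => 0 <= u <= t) l ->
  F t [set w | has (fun u => N u w < e) l].
Proof.
move=> t0; elim: l => [_|u l IH /= /andP[/andP[u0 ut] /IH Fl]].
  by case: (sF t0) => F0 _ _; congr (F t _): F0; apply/seteqP; split.
rewrite (_ : mkset _ = [set w | N u w < e] `|` [set w | has (fun u => N u w < e) l]).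
  apply: (filtration_setU uF) => //; apply: (filtration_nondecreasing uF u0 ut).
  exact: (measurable_wrtP _ (sF u0)).1 (Nadapted u0) e.
by apply/seteqP; split=> w /= /orP.
Qed.

(** Optional stopping by induction on the sampling times. If the path is below [e] at the first time
    [u], the martingale property replaces [N t] by [N u], and the integrand is negative. The
    complementary event belongs to [F u], so the induction hypothesis applies with [u] in place of
    [s]. *)
Lemma maximal_inequality_seq s t e A (l : seq R) : 0 <= s ->
  path <=%R s l -> all (fun u => u <= t) l -> s <= t -> F s A ->
  (\int[P]_(w in A `&` [set w | has (fun u => (N u w < e)%R) l]) (N t w - e)%:E <= 0)%E.
Proof.
elim: l s A => [|u l IH] s A s0 /=.
  move=> _ _ _ _; rewrite (_ : _ `&` _ = set0) ?integral_set0//.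
  by apply/seteqP; split=> w //= [].
move=> /andP[su ul] /andP[ut lt] st FA; have t0 := le_trans s0 st.
have u0 := le_trans s0 su.
have FuA := filtration_nondecreasing uF s0 su FA.
set L := [set w | N u w < e].
have FL : F u L by exact: (measurable_wrtP _ (sF u0)).1 (Nadapted u0) e.
have FAL : F u (A `&` L) by exact: (filtration_setI uF).
have FAL' : F u (A `&` ~` L).
  by apply: (filtration_setI uF) => //; exact: (filtration_setC uF).
pose H := [set w | has (fun u => N u w < e) l].
have FH : F t H.
  apply: filtration_has_lt => //; apply/allP => v vl.
  rewrite (allP lt) // andbT (le_trans u0) //.
  by move/order_path_min : ul => /(_ (@le_trans _ _))/allP; apply.
have mAL := mF u0 FAL.
have mALH : measurable ((A `&` ~` L) `&` H) by apply: measurableI; [exact: mF FAL'|exact: mF FH].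
rewrite (_ : A `&` _ = (A `&` L) `|` ((A `&` ~` L) `&` H)); last first.
  apply/seteqP; split=> w /=.
    by move=> [Aw /orP[Nw|Hw]]; [left|have [Lw|Lw] := pselect (L w); [left|right]].
  by move=> [[Aw Lw]|[[Aw _] Hw]]; split=> //; apply/orP; [left|right].
rewrite integral_setU //.
- rewrite -[0%E]adde0; apply: leeD; last by apply: (IH u _ u0) => //; exact: le_trans ut.
  rewrite (martingale_integral_subcst e u0 ut FAL) -(integral0 P (A `&` L)).
  apply: le_integral => //; first exact: integrable_subcst.
    exact: integrable0.
  by move=> w; rewrite inE => -[_ /ltW]; rewrite lee_fin subr_le0.
- by apply/measurable_EFinP; apply: measurable_funTS; apply: measurable_funB => //; exact: mN.
- by apply/disj_setPS => w /= [[_ Lw] [[_]]].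
Qed.

(** Clamped rationals detect every passage of a continuous path below [e], so the events built from
    finitely many of them eventually agree with the full event at almost every [w]. *)
Lemma maximal_inequality_lt s t e A : 0 <= s -> s <= t -> F s A ->
  (\int[P]_(w in A `&` [set w | exists2 u, (s <= u <= t)%R & (N u w < e)%R])
     (N t w - e)%:E <= 0)%E.
Proof.
move=> s0 st FA; have t0 := le_trans s0 st.
pose clamp (q : rat) := Num.max s (Num.min t (ratr q)) : R.
have clampP q : s <= clamp q <= t.
  by rewrite le_max lexx /= ge_max st ge_min lexx.
(* The rationals with code less than [n], clamped to [s, t] and sorted so that they can serve as
   successive sampling times. *)
pose l n := sort <=%R [seq clamp q | q <- pmap unpickle (iota 0 n)].
have lP n : all (fun u => s <= u <= t) (l n).
  by apply/allP => u; rewrite mem_sort => /mapP[q _ ->].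
have FAt := filtration_nondecreasing uF s0 st FA.
apply: (@dominated_integral_le0 _ _ _ P
  (fun n => A `&` [set w | has (fun u => N u w < e) (l n)]) _
  (fun=> fun w => N t w - e) _ (fun w => `|N t w - e|)).
- move=> n; apply: (mF t0); apply: (filtration_setI uF) => //.
  apply: filtration_has_lt => //; apply/allP => u /(allP (lP n)) /andP[su ->].
  by rewrite (le_trans s0 su).
- apply: (mF t0); apply: (filtration_setI uF) => //.
  exact: (filtration_lt_on_itv uF).
- by move=> _; apply: measurable_funB => //; exact: mN.
- by apply: measurable_funB => //; exact: mN.
- apply: filterS Ncont => w Nw.
  have [[q Nq]|noq] := pselect (exists q, N (clamp q) w < e); last first.
    apply: nearW => n; split=> -[Aw]; last by move/(lt_on_itv_rat e s0 st Nw).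
    move=> /hasP[u]; rewrite mem_sort => /mapP[q _ ->] Nq.
    by case: noq; exists q.
  near=> n; split=> -[Aw _]; split=> //; first by apply/(lt_on_itv_rat e s0 st Nw); exists q.
  apply/hasP; exists (clamp q) => //; rewrite mem_sort; apply/map_f.
  rewrite mem_pmap; apply/mapP; exists (pickle q); last by rewrite pickleK.
  by rewrite mem_iota /= add0n; near: n; exact: nbhs_infty_gt.
- by move=> w; exact: cvg_cst.
- exact: (integrable_abse (integrable_subcst e t0 measurableT)).
- by [].
- move=> n; apply: (maximal_inequality_seq e s0 _ _ st FA).
  + rewrite path_min_sorted; first exact/sort_sorted/le_total.
    by apply/allP => u /(allP (lP n)) /andP[].
  + by apply/allP => u /(allP (lP n)) /andP[].
Unshelve. all: by end_near. Qed.

(* The levels [e + 1/(n+1)] decrease to [e]; since [A] forces the path above [e]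
   before time [s], only times in [s, t] matter. *)
Lemma maximal_inequality s t e A : 0 <= s -> s <= t -> F s A ->
  (forall w, A w -> e < running_inf N s w) ->
  (\int[P]_(w in A `&` [set w | (running_inf N t w <= e)%R])
     (N t w - e)%:E <= 0)%E.
Proof.
move=> s0 st FA Ae; have t0 := le_trans s0 st.
have FAt := filtration_nondecreasing uF s0 st FA.
have aJ := adapted_running_inf uF Nadapted Ncont.
have FJ : F t [set w | running_inf N t w <= e].
  rewrite (_ : mkset _ = ~` [set w | e < running_inf N t w]).
    apply: (filtration_setC uF) => //; apply: (filtration_ltr uF) => //.
      by apply: measurable_cst.
    exact: aJ.
  by apply/seteqP; split=> w /=; rewrite leNgt => /negP.
have mNe c : measurable_fun setT (fun w => N t w - c).
  by apply: measurable_funB => //; exact: mN.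
(* In the dominating function, the [+ 1] absorbs [harmonic n], which is at most 1. *)
apply: (@dominated_integral_le0 _ _ _ P
  (fun n => A `&` [set w | exists2 u, s <= u <= t & N u w < e + harmonic n]) _
  (fun n w => N t w - (e + harmonic n)) _ (fun w => `|N t w - e| + 1)).
- move=> n; apply: (mF t0); apply: (filtration_setI uF) => //.
  exact: (filtration_lt_on_itv uF).
- by apply: (mF t0); exact: (filtration_setI uF).
- by move=> n; exact: mNe.
- exact: mNe.
- apply: filterS Ncont => w Nw.
  have [Jte|eJt] := leP (running_inf N t w) e.
    apply: nearW => n; split=> -[Aw _]; split=> //=.
    have [u /andP[u0 ut] Nu] := (running_inf_leP Nw e t0).1 Jte.
    exists u; last by rewrite (le_lt_trans Nu) // ltrDl invr_gt0 ltr0Sn.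
    rewrite ut andbT leNgt; apply/negP => /ltW us.
    have := Ae _ Aw; rewrite ltNge => /negP; apply; apply: le_trans Nu.
    by apply: running_inf_le => //; rewrite u0.
  have J0 : 0 < running_inf N t w - e by rewrite subr_gt0.
  near=> n; split=> -[Aw].
    move=> [u /andP[su ut] Nu].
    have := @running_inf_le _ _ _ _ Nw u t; rewrite ut (le_trans s0 su) => /(_ isT).
    have : harmonic n < running_inf N t w - e.
      by near: n; exact: (near_infty_natSinv_lt (PosNum J0)).
    lra.
  by move=> /= Jte; move: eJt; rewrite ltNge Jte.
- move=> w; apply: cvgB; first exact: cvg_cst.
  rewrite -[X in _ --> X]addr0; apply: cvgD; first exact: cvg_cst.
  exact: cvg_harmonic.
- rewrite (_ : _ \o _ = fun w => (abse \o (EFin \o (fun w => (N t w - e)%R))) w + (EFin \o cst 1%R) w)%E //.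
  apply: integrableD => //; last exact: finite_measure_integrable_cst.
  exact: (integrable_abse (integrable_subcst e t0 measurableT)).
- move=> n w; rewrite opprD addrA (le_trans (ler_normB _ _)) // lerD2l.
  by rewrite ger0_norm ?invr_ge0 // invf_le1 // ler1n.
- by move=> n; exact: maximal_inequality_lt.
Unshelve. all: by end_near. Qed.

End maximal_inequality.

(** * The ratio stopped at a positive level: pathwise bounds *)

Section stopped_ratio.
Context {T : Type} {R : realType}.
Implicit Types (N : R -> T -> R) (e s t : R) (w : T).

(* The process [Ystar] stopped when the running infimum of [N] reaches [e]. *)
Definition stopped_ratio N e t w : R :=
  if e < running_inf N t w then N t w / running_inf N t w - 1 else 0.

(* [inf] of a set which is not bounded below is [0]. *)
Lemma running_inf_le_gt0 N s t w : 0 < running_inf N t w -> 0 <= s <= t ->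
  running_inf N t w <= N s w.
Proof.
move=> J0 st; have [hi|/inf_out] := pselect (has_inf [set N u w | u in `[0, t]]).
  by apply: ge_inf; [case: hi|exists s; rewrite //= in_itv].
by move=> J00; move: J0; rewrite /running_inf J00 ltxx.
Qed.

(** Positivity of the infimum replaces continuity of the path, so no exceptional null set enters. *)
Lemma running_inf_antitone_gt0 N s t w : 0 < running_inf N t w ->
  0 <= s -> s <= t -> running_inf N t w <= running_inf N s w.
Proof.
move=> J0 s0 st; apply: lb_le_inf.
  by exists (N 0 w), 0; rewrite //= in_itv /= lexx.
move=> _ [u + <-]; rewrite /= in_itv /= => /andP[u0 us].
by apply: running_inf_le_gt0; rewrite // u0 (le_trans us).
Qed.

Lemma stopped_ratio_ge0 N e t w : 0 < e -> 0 <= t -> 0 <= stopped_ratio N e t w.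
Proof.
move=> e0 t0; rewrite /stopped_ratio; case: ifPn => // /(lt_trans e0) J0.
by rewrite subr_ge0 ler_pdivlMr // mul1r running_inf_le_gt0 // t0 lexx.
Qed.

(** Before the level is reached, dividing by the infimum costs a factor of at most 1/e.
    Integrability of the stopped ratio rests on this bound. *)
Lemma norm_stopped_ratio_le N e t w : 0 < e ->
  `|stopped_ratio N e t w| <= e^-1 * `|N t w| + 1.
Proof.
move=> e0; rewrite /stopped_ratio; case: ifPn => [eJ|_]; last first.
  by rewrite normr0 addr_ge0 // mulr_ge0 // invr_ge0 ltW.
rewrite (le_trans (ler_normB _ _)) // normr1 lerD2r normrM mulrC.
have J0 := lt_trans e0 eJ.
by rewrite ler_wpM2r // ger0_norm ?invr_ge0 ?ltW // ltf_pV2 // posrE.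
Qed.

End stopped_ratio.

(** * The stopped ratio is a submartingale *)

Section stopped_ratio_submartingale.
Context {d : measure_display} {T : measurableType d} {R : realType}.
Variables (P : probability T R) (F : R -> set (set T)) (N : R -> T -> R).
Hypotheses (uF : usual_filtration P F) (Nmart : martingale P F N)
  (Ncont : continuous_process P N).
Variable e : R.
Hypothesis e0 : 0 < e.
Implicit Types (s t u c : R) (A B : set T) (X Z : T -> R).

Local Notation J := (running_inf N).
Local Notation V := (stopped_ratio N e).

Let Nadapted : adapted F N. Proof. by case: Nmart. Qed.

Let sF t : 0 <= t -> sigma_algebra setT (F t).
Proof. exact: (filtration_sigma_algebra uF). Qed.

Let mF t A : 0 <= t -> F t A -> measurable A.
Proof. by move=> t0; exact: (filtration_measurable uF t0). Qed.

Let iN t A : 0 <= t -> measurable A -> P.-integrable A (EFin \o N t).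
Proof.
by move=> t0 mA; apply: (integrableS measurableT) => //; case: Nmart => _ + _; apply.
Qed.

Let Jadapted : adapted F J. Proof. exact: (adapted_running_inf uF). Qed.

Lemma adapted_stopped_ratio : adapted F V.
Proof.
move=> t t0; have mN := Nadapted t0; have mJ := Jadapted t0.
(* On the branch [e < J t w] the infimum is positive, so its inverse is its power of exponent -1, a
   measurable function of it. *)
rewrite /measurable_wrt (_ : V t = fun w =>
    if e < J t w then N t w * (J t w `^ (-1)) - 1 else 0); last first.
  apply/funext => w; rewrite /stopped_ratio; case: ifPn => // /(lt_trans e0) J0.
  by rewrite powR_inv1 // ltW.
apply: measurable_fun_ifT; first exact: measurable_fun_ltr.
  apply: measurable_funB; last exact: measurable_cst.
  apply: measurable_funM => //.
  exact: (measurableT_comp (measurable_powR (-1))).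
exact: measurable_cst.
Qed.

Lemma integrable_stopped_ratio t A : 0 <= t -> measurable A ->
  P.-integrable A (EFin \o V t).
Proof.
move=> t0 mA; apply: (integrableS measurableT) => //.
apply: (@le_integrable _ _ _ P _ _ _ (EFin \o (fun w => e^-1 * `|N t w| + 1))) => //.
- apply/measurable_EFinP; apply: (adapted_measurable_fun uF t0).
  exact: adapted_stopped_ratio.
- move=> w _; rewrite /= lee_fin (le_trans (norm_stopped_ratio_le _ _ _ e0)) //.
  exact: ler_norm.
rewrite (_ : _ \o _ = fun w => (e^-1)%:E * (abse \o (EFin \o N t)) w +
  (EFin \o cst 1%R) w)%E //.
apply: integrableD => //; last exact: finite_measure_integrable_cst.
by apply: integrableZl => //; apply: integrable_abse; exact: iN.
Qed.

(** Applied once to [N s] with a conditional expectation and once to [N t] with [V t], so that the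
    two integrals can be matched term by term. *)
Lemma integral_affine A X Z c : measurable A ->
  P.-integrable A (EFin \o X) -> P.-integrable A (EFin \o Z) ->
  P.-integrable A (EFin \o (fun w => X w - (c * Z w + c))) /\
  (\int[P]_(w in A) (X w - (c * Z w + c))%:E =
   \int[P]_(w in A) (X w)%:E -
     (c%:E * \int[P]_(w in A) (Z w)%:E + \int[P]_(w in A) c%:E))%E.
Proof.
move=> mA iX iZ.
have icZ : P.-integrable A (fun w => c%:E * (EFin \o Z) w)%E by exact: integrableZl.
have ic : P.-integrable A (EFin \o cst c).
  by apply: (integrableS measurableT) => //; exact: finite_measure_integrable_cst.
have icZc := integrableD mA icZ ic.
split; first exact: (integrableB mA iX icZc).
by rewrite -(integralZl mA iZ) -(integralD mA icZ ic) -(integralB mA iX icZc).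
Qed.

(* On [A] the ratio [N_t / J_t] is bounded below by [N_t / c], up to the
   contribution of [J_t <= e], which the maximal inequality controls. *)
Lemma negligible_below s t c Z : 0 <= s -> s <= t ->
  is_cond_exp P (F s) (V t) Z ->
  P.-negligible [set w | [/\ c * Z w + c < N s w, e < J s w & J s w <= c]].
Proof.
move=> s0 st [mZ iZ ZE]; have t0 := le_trans s0 st.
set A := mkset _.
have FA : F s A.
  rewrite (_ : A = [set w | c * Z w + c < N s w] `&`
      ([set w | e < J s w] `&` ~` [set w | c < J s w])); last first.
    apply/seteqP; split=> w /=; first by move=> [? ? ?]; split=> //; split=> //; apply/negP; rewrite -leNgt.
    by move=> [? [? /negP]]; rewrite -leNgt.
  apply: (filtration_setI uF) => //.
    apply: (filtration_ltr uF) => //; last exact: Nadapted.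
    by apply: measurable_funD => //; apply: measurable_funM.
  apply: (filtration_setI uF) => //.
    by apply: (filtration_ltr uF) => //; [exact: measurable_cst|exact: Jadapted].
  apply: (filtration_setC uF) => //.
  by apply: (filtration_ltr uF) => //; [exact: measurable_cst|exact: Jadapted].
have mA := mF s0 FA.
have FAt := filtration_nondecreasing uF s0 st FA.
have iZA : P.-integrable A (EFin \o Z) by exact: (integrableS measurableT).
have iVA := integrable_stopped_ratio t0 mA.
have [iNsZ NsZE] := integral_affine c mA (iN s0 mA) iZA.
have [iNtV NtVE] := integral_affine c mA (iN t0 mA) iVA.
apply: (negligible_integral_le0 mA iNsZ).
  by move=> w [? _ _]; rewrite subr_gt0.
have NE : (\int[P]_(w in A) (N s w)%:E = \int[P]_(w in A) (N t w)%:E)%E.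
  by case: Nmart => _ _ /(_ s t s0 st)[_ _ ->].
(* Since [A] is in [F s], [N s] and [Z] may be replaced under the integral by [N t] and [V t]. *)
rewrite NsZE NE ZE // -NtVE.
have Ae w : A w -> e < J s w by case.
apply: le_trans (maximal_inequality uF Nmart Ncont s0 st FA Ae).
rewrite integral_mkcondr.
have mJ : measurable [set w | J t w <= e].
  rewrite (_ : mkset _ = ~` [set w | e < J t w]).
    apply: measurableC; apply: (mF t0); apply: (filtration_ltr uF) => //.
      exact: measurable_cst.
    exact: Jadapted.
  by apply/seteqP; split=> w /=; rewrite leNgt => /negP.
apply: le_integral => //.
  apply/(integrable_restrict _ mJ mA).
  exact: (integrable_subcst Nmart e t0 (measurableI _ _ mA mJ)).
move=> w; rewrite inE => -[_ eJs Jsc]; rewrite restrict_EFin /= lee_fin patchE.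
rewrite /stopped_ratio; have [eJt|Jte] := ltP e (J t w).
  rewrite memNset /=; last by apply/negP; rewrite -ltNge.
  have Jt0 := lt_trans e0 eJt.
  have := running_inf_antitone_gt0 Jt0 s0 st.
  have : J t w <= N t w by apply: running_inf_le_gt0; rewrite // t0 lexx.
  set x := N t w; set y := J t w in Jt0 *; move=> yx yJs.
  (* Here V_t + 1 = x/y with 0 < y <= J_s <= c, so the integrand (1 - c/y) x is nonpositive. *)
  rewrite (_ : c * _ + c = c / y * x); last by field; rewrite gt_eqF.
  rewrite -[X in X - _]mul1r -mulrBl mulr_le0_ge0 //; last by rewrite (le_trans (ltW Jt0)).
  by rewrite subr_le0 ler_pdivlMr // mul1r (le_trans yJs).
(* Once the level is reached V_t = 0, and N_t - c <= N_t - e because e < J_s <= c. *)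
by rewrite mem_set //= mulr0 add0r lerB // ltW // (lt_le_trans eJs).
Qed.

Lemma stopped_ratio_submartingale : submartingale P F V.
Proof.
split; first exact: adapted_stopped_ratio.
  by move=> t t0; exact: integrable_stopped_ratio.
move=> s t s0 st; have t0 := le_trans s0 st.
have [Z ZV] := cond_exp_exists (sF s0) (filtration_measurable uF s0)
  (integrable_stopped_ratio t0 measurableT).
exists Z => //; have [mZ iZ ZE] := ZV.
(* This settles the case [J s w <= e], where [V s w] is 0. It holds because [Z] and the nonnegative
   [V t] have the same integral over the event [Z < 0]. *)
have Z_ge0 : {ae P, forall w, 0 <= Z w}.
  have FA : F s [set w | Z w < 0] by exact: (measurable_wrtP _ (sF s0)).1 mZ 0.
  have mA := mF s0 FA.
  have iZA : P.-integrable [set w | Z w < 0] (EFin \o Z)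
    by exact: (integrableS measurableT).
  have : P.-negligible [set w | Z w < 0].
    apply: (negligible_integral_le0 mA (integrableN iZA)).
      by move=> w; rewrite /= oppr_gt0.
    under eq_integral do rewrite EFinN.
    rewrite integralN; last exact: integrable_add_def.
    rewrite leeNl oppe0 ZE //; apply: integral_ge0 => w _.
    by rewrite lee_fin stopped_ratio_ge0.
  by apply: negligibleS => w /= /negP; rewrite -ltNge.
(* Coding rationals by integers makes this a countable intersection of almost sure events. *)
have : {ae P, forall w, forall n, if unpickle n is Some q then
    ~ [/\ ratr q * Z w + ratr q < N s w, e < J s w & J s w <= ratr q] else True}.
  apply: ae_foralln => n; case: (unpickle n) => [q|]; last exact: aeW.
  have := negligible_below (ratr q) s0 st ZV.
  by apply: negligibleS => w /= /contrapT.
apply: filterS2 Z_ge0 => w Z0 Hq.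
rewrite /stopped_ratio; case: ifPn => // eJ; have J0 := lt_trans e0 eJ.
rewrite leNgt; apply/negP => ZV'.
have Z1 : 0 < Z w + 1 by rewrite ltr_wpDl.
(* If the submartingale inequality failed at [w], this interval would be nonempty, and any rational
   in it would put [w] in one of the excluded null sets. *)
have [q] : exists q : rat, ratr q \in `]J s w, N s w / (Z w + 1)[.
  have JN : J s w * (Z w + 1) < N s w.
    by rewrite mulrC -ltr_pdivlMr // -ltrBrDr.
  have [q qi] := @rat_in_itvoo R (J s w) (N s w / (Z w + 1)) ltac:(by rewrite ltr_pdivlMr).
  by exists q.
rewrite in_itv /= => /andP[Jq qN].
have := Hq (pickle q); rewrite pickleK; apply; split=> //; last exact: ltW.
by move: qN; rewrite ltr_pdivlMr // mulrDr mulr1.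
Qed.

End stopped_ratio_submartingale.

(** * Hitting times of a level *)

Section hitting_time.
Context {T : Type} {R : realType}.
Implicit Types (M : R -> T -> R) (e t : R) (w : T).

(** A path that stays above [e] gets [+oo], the infimum of the empty set. *)
Definition hitting M e w : \bar R :=
  ereal_inf [set t%:E | t in [set t | 0 <= t /\ M t w <= e]].

Lemma hitting_ge0 M e w : (0 <= hitting M e w)%E.
Proof. by apply: le_ereal_inf_tmp => _ [t [t0 _] <-]; rewrite lee_fin. Qed.

Lemma hitting_antitone M e1 e2 w : e1 <= e2 ->
  (hitting M e2 w <= hitting M e1 w)%E.
Proof.
move=> e12; apply: ereal_inf_le_tmp => _ [t [t0 Mt] <-]; exists t => //.
by split=> //; exact: le_trans e12.
Qed.

End hitting_time.

(** * Stopped paths and their running infimum *)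

Section stopped_paths.
Context {d : measure_display} {T : measurableType d} {R : realType}.
Variables (M : R -> T -> R) (w : T).
Hypothesis Mc : {within `[0, +oo[, continuous (fun t => M t w)}.
Implicit Types (tau : T -> \bar R) (a e r s t u : R).

Let stop tau t : R := fine (Order.min t%:E (tau w)).

Let stopE tau t : (0 <= tau w)%E -> (stop tau t)%:E = Order.min t%:E (tau w).
Proof.
rewrite /stop; case: (tau w) => [r| |] //= _; last by rewrite miney.
by rewrite -EFin_min.
Qed.

Let stop_ge0 tau t : (0 <= tau w)%E -> 0 <= t -> 0 <= stop tau t.
Proof. by move=> w0 t0; rewrite -lee_fin stopE // le_min w0 lee_fin t0. Qed.

Let stop_le tau s t : (0 <= tau w)%E -> (s <= stop tau t) = (s <= t) && (s%:E <= tau w)%E.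
Proof. by move=> w0; rewrite -lee_fin stopE // le_min lee_fin. Qed.

Let stop_id tau t : (t%:E <= tau w)%E -> stop tau t = t.
Proof. by rewrite /stop => tw; rewrite min_l. Qed.

Let stop_lipschitz tau t u : (0 <= tau w)%E -> `|stop tau t - stop tau u| <= `|t - u|.
Proof.
rewrite /stop; case: (tau w) => [r| |] //= _; last by rewrite !miney.
rewrite -!EFin_min /=.
have half a b : a <= b -> `|Num.min a r - Num.min b r| <= `|a - b|.
  move=> ab; rewrite distrC [leRHS]distrC !ger0_norm ?subr_ge0 //.
    by case: (leP a r) => ar; case: (leP b r) => br; lra.
  by rewrite le_min !ge_min lexx ab orbT.
by have [/half//|/ltW/half] := leP t u; rewrite distrC [leRHS]distrC.
Qed.

(** Stopping the clock is 1-Lipschitz, so a radius valid for the path at the stopped time is valid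
    for the stopped path at [t]. *)
Lemma continuous_stopped tau : (0 <= tau w)%E ->
  {within `[0, +oo[, continuous (fun t => stopped M tau t w)}.
Proof.
move=> w0; apply/continuous_halflineP => t e t0 e0.
have [r r0 rP] := (continuous_halflineP _).1 Mc _ _ (stop_ge0 w0 t0) e0.
exists r => // u u0 tu; apply: rP; first exact: stop_ge0.
exact: le_lt_trans (stop_lipschitz _ _ w0) tu.
Qed.

(** Both infima run over the same set of values: the clock stopped at [tau w] sweeps exactly the
    times up to min(t, tau). *)
Lemma running_inf_stopped tau t : (0 <= tau w)%E -> 0 <= t ->
  running_inf (stopped M tau) t w =
  running_inf M (fine (Order.min t%:E (tau w))) w.
Proof.
move=> w0 t0; congr inf; apply/seteqP; split=> _ [s + <-];
  rewrite /= in_itv /= => /andP[s0].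
  move=> st; exists (stop tau s) => //; rewrite /= in_itv /= stop_ge0 //=.
  rewrite -/(stop tau t) stop_le //; apply/andP; split.
    by apply: (le_trans _ st); rewrite -lee_fin stopE // ge_min lexx.
  by rewrite stopE // ge_min lexx orbT.
rewrite -/(stop tau t) stop_le // => /andP[st sw]; exists s; first by rewrite /= in_itv /= s0.
by rewrite /stopped -/(stop tau s) stop_id.
Qed.

Lemma hitting_leP e t : 0 <= t ->
  (hitting M e w <= t%:E)%E <-> running_inf M t w <= e.
Proof.
move=> t0; split=> [|/(running_inf_leP Mc e t0)[u /andP[u0 ut] Mu]]; last first.
  by apply: (@le_trans _ _ u%:E); [apply: ereal_inf_lbound; exists u|rewrite lee_fin].
apply: contraTT; rewrite -!ltNge => eJ.
have [r r0 rP] := (continuous_halflineP _).1 (continuous_running_inf Mc) t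
  (running_inf M t w - e) t0 ltac:(by rewrite subr_gt0).
(* By continuity the running infimum still exceeds [e] at t + r/2, so the level is not reached
   before that time. *)
apply: (@lt_le_trans _ _ (t + r / 2)%:E); first by rewrite lte_fin ltrDl divr_gt0.
apply: le_ereal_inf_tmp => _ [u [u0 Mu] <-]; rewrite lee_fin leNgt; apply/negP => ut.
have tr0 : 0 <= t + r / 2 by rewrite addr_ge0 // divr_ge0 // ltW.
have : `|t - (t + r / 2)| < r by rewrite opprD addrA subrr sub0r normrN ger0_norm; lra.
move=> /(rP _ tr0); have := @running_inf_le _ _ _ _ Mc u (t + r / 2).
rewrite u0 (ltW ut) => /(_ isT); rewrite ltr_norml => ? /andP[]; lra.
Qed.

(* At the hitting time the path attains its running infimum. *)
Lemma Ystar_hitting e r : 0 < M r w -> hitting M e w = r%:E -> Ystar M r w = 0.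
Proof.
move=> Mr hr; have r0 : 0 <= r by rewrite -lee_fin -hr hitting_ge0.
have := (hitting_leP e r0).1; rewrite hr lexx => /(_ isT) Je.
have [u /andP[u0 ur] [JE _]] := running_inf_attained Mc r0.
have ru : r <= u.
  by rewrite -lee_fin -hr; apply: ereal_inf_lbound; exists u => //; split=> //; rewrite -JE.
have uE : u = r by apply/eqP; rewrite eq_le ur ru.
by rewrite /Ystar JE uE divff ?gt_eqF // subrr.
Qed.

(** While the stopped infimum exceeds [e], the level has not been hit and both sides are the same
    ratio. Afterwards the left side is frozen at the hitting time, where [Ystar] vanishes, which
    matches the value 0 in [stopped_ratio]. *)
Lemma stopped_Ystar tau e t : (0 <= tau w)%E ->
  (forall s, 0 <= s -> 0 < M s w) -> 0 <= t ->
  stopped (Ystar M) (fun v => Order.min (tau v) (hitting M e v)) t w =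
  stopped_ratio (stopped M tau) e t w.
Proof.
move=> w0 M0 t0; have a0 := stop_ge0 w0 t0.
rewrite /stopped_ratio running_inf_stopped // {1}/stopped minA -stopE //.
rewrite /stopped -/(stop tau t); set a := stop tau t in a0 *.
case: ifPn => [eJ|]; first rewrite min_l //.
  rewrite leNgt; apply/negP => /ltW /(hitting_leP e a0).
  by rewrite leNgt eJ.
rewrite -leNgt => /(hitting_leP e a0) ha; rewrite min_r //.
have [r hr] : exists r, hitting M e w = r%:E.
  case: (hitting M e w) (hitting_ge0 M e w) ha => [r| |] //; by exists r.
rewrite hr; apply: (Ystar_hitting (e := e)) => //; apply: M0.
by rewrite -lee_fin -hr hitting_ge0.
Qed.

End stopped_paths.

(** * Modifications of submartingales, and stopping times *)

Section modifications.
Context {d : measure_display} {T : measurableType d} {R : realType}.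
Variables (P : probability T R) (F : R -> set (set T)).
Hypothesis uF : usual_filtration P F.

(** Integrals ignore null sets, and completeness of the filtration carries adaptedness over. This is
    what makes the identity [stopped_Ystar] usable, as it holds only on continuous positive
    paths. *)
Lemma submartingale_modification (X Y : R -> T -> R) :
  (forall t, 0 <= t -> {ae P, forall w, X t w = Y t w}) ->
  submartingale P F X -> submartingale P F Y.
Proof.
move=> XY [aX iX sX].
have aY : adapted F Y.
  by move=> t t0; apply: (measurable_wrt_ae uF t0 (XY t t0)); exact: aX.
have mX t : 0 <= t -> measurable_fun setT (X t).
  by move=> t0; apply: (adapted_measurable_fun uF t0); exact: aX.
have mY t : 0 <= t -> measurable_fun setT (Y t).
  by move=> t0; apply: (adapted_measurable_fun uF t0); exact: aY.
have XYint t A : 0 <= t -> measurable A ->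
    (\int[P]_(w in A) (X t w)%:E = \int[P]_(w in A) (Y t w)%:E)%E.
  move=> t0 mA; apply: ae_eq_integral => //.
  - by apply/measurable_EFinP; apply: measurable_funTS; exact: mX.
  - by apply/measurable_EFinP; apply: measurable_funTS; exact: mY.
  - by apply: filterS (XY t t0) => w ->.
split=> // [t t0|s t s0 st].
  have mEY : measurable_fun setT (EFin \o Y t) by apply/measurable_EFinP; exact: mY.
  apply/integrableP; split => //.
  have /integrableP[mEX] := iX t t0; apply: le_lt_trans.
  rewrite le_eqVlt; apply/orP; left; apply/eqP; apply: ae_eq_integral => //.
  - exact: measurableT_comp.
  - exact: measurableT_comp.
  - by apply: filterS (XY t t0) => w /= -> _.
have t0 := le_trans s0 st.
have [Z [mZ iZ ZE] XZ] := sX s t s0 st; exists Z.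
  split=> // A FA; rewrite ZE // XYint //.
  exact: (filtration_measurable uF s0).
by apply: filterS2 (XY s s0) XZ => w ->.
Qed.

(** Up to a null set, the level is hit by time [t] exactly when the running infimum at [t] is at
    most [e], and that infimum is adapted. *)
Lemma stopping_time_hitting (M : R -> T -> R) e : adapted F M ->
  continuous_process P M -> stopping_time F (hitting M e).
Proof.
move=> aM cM; split=> [w|t t0]; first exact: hitting_ge0.
have mJ := adapted_running_inf uF aM cM t0.
apply: (@filtration_ae _ _ _ _ _ uF _ (~` [set w | e < running_inf M t w])) => //.
  apply: filterS cM => w Mw /=; split=> [/negP|/(hitting_leP Mw e t0)].
    by rewrite -leNgt => ?; apply/(hitting_leP Mw e t0).
  by rewrite leNgt => /negP.
apply: (filtration_setC uF) => //.
by apply: (filtration_ltr uF) => //; exact: measurable_cst.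
Qed.

Lemma stopping_time_min (tau sigma : T -> \bar R) : stopping_time F tau ->
  stopping_time F sigma ->
  stopping_time F (fun w => Order.min (tau w) (sigma w)).
Proof.
move=> [tau0 Ftau] [sigma0 Fsigma]; split=> [w|t t0].
  by rewrite le_min tau0 sigma0.
rewrite (_ : mkset _ = [set w | (tau w <= t%:E)%E] `|` [set w | (sigma w <= t%:E)%E]).
  by apply: (filtration_setU uF) => //; [exact: Ftau|exact: Fsigma].
by apply/seteqP; split=> w /=; rewrite ge_min => /orP.
Qed.

End modifications.

(** * Membership of [Ystar] in the class, and its minimality *)

Section Ystar_in_class.
Context {d : measure_display} {T : measurableType d} {R : realType}.
Variables (P : probability T R) (F : R -> set (set T)) (M : R -> T -> R).
Hypotheses (uF : usual_filtration P F) (Mcont : continuous_process P M)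
  (Mpos : positive_process P M).

Let Mpath : {ae P, forall w, {within `[0, +oo[, continuous (fun t => M t w)} /\
  forall t, 0 <= t -> 0 < M t w}.
Proof. by apply: filterS2 Mcont Mpos => w. Qed.

Let level n : R := n.+2%:R^-1.

Lemma localizing_min_hitting (tau : nat -> T -> \bar R) : adapted F M ->
  localizing P F tau ->
  localizing P F (fun n w => Order.min (tau n w) (hitting M (level n) w)).
Proof.
move=> aM [st mono lim]; split.
- by move=> n; apply: (stopping_time_min uF) => //; exact: (stopping_time_hitting uF).
- apply: filterS mono => w tw m n mn; rewrite le_min !ge_min tw //=.
  rewrite hitting_antitone ?orbT // lef_pV2 ?posrE ?ltr0Sn //.
  by rewrite ler_nat.
- apply: filterS2 lim Mpath => w tauw [Mc M0].
  apply/cvgeyPge => a.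
  (* A positive continuous path stays away from 0 on [0, |a|], so levels below its infimum there are
     not hit by time |a|. The absolute value allows for a negative bound [a]. *)
  have J0 : 0 < running_inf M `|a| w by apply: running_inf_gt0.
  near=> n; rewrite le_min; apply/andP; split.
    by near: n; move/cvgeyPge : tauw; exact.
  apply: (@le_trans _ _ (`|a|)%:E); first by rewrite lee_fin ler_norm.
  rewrite leNgt; apply/negP => /ltW /(hitting_leP Mc _ (normr_ge0 _)).
  apply/negP; rewrite -ltNge (@le_lt_trans _ _ (n.+1%:R^-1)) //.
    by rewrite lef_pV2 ?posrE ?ltr0Sn // ler_nat.
  by near: n; exact: (near_infty_natSinv_lt (PosNum J0)).
Unshelve. all: by end_near. Qed.

Lemma local_submartingale_Ystar : adapted F (Ystar M) ->
  local_martingale P F M -> local_submartingale P F (Ystar M).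
Proof.
move=> aY [aM [tau ltau Mtau]]; split=> //.
exists (fun n w => Order.min (tau n w) (hitting M (level n) w)).
  exact: localizing_min_hitting.
move=> n; have [/(_ n)[tau0 _] _ _] := ltau.
apply: (@submartingale_modification _ _ _ _ _ uF
    (stopped_ratio (stopped M (tau n)) (level n))).
  move=> t t0; apply: filterS Mpath => w [Mc M0].
  by apply/esym; exact: stopped_Ystar.
apply: stopped_ratio_submartingale => //; last by rewrite invr_gt0 ltr0Sn.
by apply: filterS Mcont => w Mc; exact: continuous_stopped.
Qed.

Lemma adapted_inv_running_inf : adapted F M ->
  adapted F (fun t w => (running_inf M t w)^-1).
Proof.
move=> aM t t0.
apply: (@measurable_wrt_ae _ _ _ _ _ uF _ (fun w => running_inf M t w `^ (-1))) => //.
  apply: filterS Mpath => w [Mc M0]; rewrite powR_inv1 //.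
  by apply: ltW; exact: running_inf_gt0.
apply: (measurableT_comp (measurable_powR (-1))).
exact: (adapted_running_inf uF).
Qed.

Lemma adapted_Ystar : adapted F M -> adapted F (Ystar M).
Proof.
move=> aM t t0; apply: measurable_funB; last exact: measurable_cst.
by apply: measurable_funM; [exact: aM|exact: adapted_inv_running_inf].
Qed.

Lemma continuous_inv_running_inf :
  continuous_process P (fun t w => (running_inf M t w)^-1).
Proof.
apply: filterS Mpath => w [Mc M0]; apply/subspace_continuousP => t t_ge0.
have t0 : 0 <= t by move: t_ge0; rewrite /= in_itv /= andbT.
apply: cvgV; first by rewrite gt_eqF // running_inf_gt0.
by move/subspace_continuousP : (continuous_running_inf Mc); exact.
Qed.

Lemma continuous_Ystar : continuous_process P (Ystar M).
Proof.
apply: filterS2 Mcont continuous_inv_running_inf => w Mc Ic.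
apply/subspace_continuousP => t t0; apply: cvgB; last exact: cvg_cst.
by apply: cvgM; [move/subspace_continuousP : Mc|move/subspace_continuousP : Ic]; exact.
Qed.

Lemma Ystar_ge0 : le_process P (fun _ _ => 0) (Ystar M).
Proof.
apply: filterS Mpath => w [Mc M0] t t0; rewrite /Ystar subr_ge0.
rewrite ler_pdivlMr ?running_inf_gt0 // mul1r.
by apply: running_inf_le => //; rewrite t0 lexx.
Qed.

Hypotheses (Mloc : local_martingale P F M) (M1 : starts_at P 1 M).

Lemma Ystar_decomposition :
  multiplicative_decomposition P F (Ystar M) M (fun t w => (running_inf M t w)^-1).
Proof.
split; [by split| |by apply: aeW => w t t0].
split; [exact: continuous_inv_running_inf| |idtac|].
- by apply: adapted_inv_running_inf; case: Mloc.
- apply: filterS Mpath => w [Mc M0] s t s0 st.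
  have t0 := le_trans s0 st.
  by rewrite lef_pV2 ?posrE ?running_inf_gt0 //; exact: running_inf_antitone.
- by apply: filterS2 Mcont M1 => w Mc M1w; rewrite running_inf0 // M1w invr1.
Qed.

Lemma Ystar_in_class : submartingales_with_part P F M (Ystar M).
Proof.
split.
- exact: continuous_Ystar.
- exact: Ystar_ge0.
- apply: local_submartingale_Ystar => //.
  by apply: adapted_Ystar; case: Mloc.
- apply: filterS2 Mcont M1 => w Mc M1w.
  by rewrite /Ystar running_inf0 // M1w divr1 subrr.
- by eexists; exact: Ystar_decomposition.
Qed.

(* [C] is nondecreasing and [C_s >= 1 / M_s] because [Y_s >= 0]; take for [s] a
   time at which [M] attains its infimum over [0, t]. *)
Lemma Ystar_minimal Y : submartingales_with_part P F M Y ->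
  le_process P (Ystar M) Y.
Proof.
move=> [_ Y0 _ _ [C [_ [_ _ Cmono _] YE]]].
apply: filterS3 Mpath Cmono (filterI Y0 YE) => w [Mc M0] Cw [Yw YEw] t t0.
have [s /andP[s0 st] [JE _]] := running_inf_attained Mc t0.
rewrite YEw // /Ystar lerD2r ler_wpM2l //; first by apply: ltW; exact: M0.
rewrite JE; apply: (le_trans _ (Cw s t s0 st)).
by rewrite -[leLHS]mulr1 ler_pdivrMl ?M0 // -subr_ge0 -YEw // Yw.
Qed.

End Ystar_in_class.

Theorem corollary2p6 (R : realType) (d : measure_display)
    (T : measurableType d) (P : probability T R) (F : R -> set (set T))
    (M : R -> T -> R) :
  usual_filtration P F ->
  continuous_process P M ->
  positive_process P M ->
  local_martingale P F M ->
  starts_at P 1 M ->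
  [/\ submartingales_with_part P F M (Ystar M),
      forall Y, submartingales_with_part P F M Y -> le_process P (Ystar M) Y &
      forall Y, submartingales_with_part P F M Y ->
        {ae P, forall w, zeros Y w `<=` zeros (Ystar M) w}].
Proof.
move=> uF Mcont Mpos Mloc M1; split; first exact: Ystar_in_class.
  by move=> Y; exact: Ystar_minimal.
(* At a zero of [Y], the value of [Ystar] is squeezed between 0 and [Y]. *)
move=> Y YE; apply: filterS2 (Ystar_ge0 Mcont Mpos) (Ystar_minimal Mcont Mpos YE).
move=> w Y0 YY t [t0 Yt]; split=> //; apply/eqP; rewrite eq_le Y0 // andbT.
by rewrite -Yt; exact: YY.
Qed.
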